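(* Let $a\in\mathbb{R}$, let $b>-1$, and let $\mu$ be the standard free Meixner distribution of parameters $a,b$. (i) If $b\ge0$, then $$\phi_\mu(y)=G_{\omega_{a,b}}(y)$$ for $y$ in some neighborhood of $\infty$, where $\omega_{a,b}$ is the semicircle law of mean $a$ and variance $b$. (ii) If $-1<b<0$, let $\eta$ be the standard free Meixner distribution of parameters $a$ and $1+b\in(0,1)$, and let $$g(z)=\frac{z}{1+az+bz^2}.$$ Then, in some neighborhood of $\infty$, $$\phi_\eta(z)=G_{\omega_{a,1+b}}(z)\quad\text{and}\quad G_\mu(z)=g\big(\phi_\eta(z)\big),$$ where $\omega_{a,1+b}$ is the semicircle law of mean $a$ and variance $1+b$.
   Context: For a probability measure $\mu$ on $\mathbb{R}$: the Cauchy-Stieltjes transform is $G_\mu(z)=\int_{\mathbb{R}}\frac{1}{z-x}\,\mu(dx)$, $z\in\mathbb{C}\setminus\mathrm{supp}(\mu)$, and $F_\mu=1/G_\mu$. $F_\mu$ is one-to-one in some neighborhood of infinity, and the Voiculescu transform is $\phi_\mu(z)=F_\mu^{-1}(z)-z$ with $F_\mu^{-1}$ the right inverse of $F_\mu$ there. Jacobi-Szegő parameters $(\alpha_n)_{n\ge0},(\omega_n)_{n\ge1}$ of $\mu$: the coefficients of the recurrence $xP_n(x)=P_{n+1}(x)+\alpha_nP_n(x)+\omega_nP_{n-1}(x)$ (with $P_{-1}=0$) satisfied by the monic polynomials orthogonal with respect to $\mu$. For $a\in\mathbb{R}$ and $b>-1$, the standard (mean $0$, variance $1$) free Meixner distribution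 of parameters $a,b$ is the compactly supported probability measure on $\mathbb{R}$ whose Jacobi-Szegő parameters are $\alpha_0=0$, $\omega_1=1$, $\alpha_n=a$ for $n\ge1$, $\omega_n=1+b$ for $n\ge2$. The semicircle law of mean $a$ and variance $b>0$ is the probability measure with density $\frac{1}{2\pi b}\sqrt{4b-(x-a)^2}$ on $[a-2\sqrt b,a+2\sqrt b]$; for $b=0$ it is the Dirac mass $\delta_a$. *)

(* Defs.v *)
From HB Require Import structures.
From mathcomp Require Import all_boot all_order all_algebra.
From mathcomp Require Import all_classical all_reals all_analysis.
From mathcomp Require Import measurable_realfun complex.

Set Implicit Arguments.
Unset Strict Implicit.
Unset Printing Implicit Defensive.

Import Order.TTheory GRing.Theory Num.Theory.
Import numFieldNormedType.Exports.
Import Normc.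

Local Open Scope classical_set_scope.
Local Open Scope ring_scope.
Local Open Scope complex_scope.

(* Neighbourhoods of infinity in the complex plane: the sets that contain some
   {z : M < |z|}. *)
Definition cinfty (R : realType) : set_system R[i] :=
  filter_from [set: R] (fun M => [set z : R[i] | M < normc z]).
Arguments cinfty R : clear implicits.

#[global] Instance cinfty_filter (R : realType) : ProperFilter (cinfty R).
Proof.
apply: filter_from_proper; first apply: filter_from_filter.
- by exists 0.
- move=> r s _ _; exists (Num.max r s) => // z /=.
  by rewrite gt_max => /andP[].
- move=> M _; exists (`|M| + 1)%:C; rewrite /= expr0n/= addr0 sqrtr_sqr.
  by rewrite ger0_norm ?addr_ge0// (le_lt_trans (ler_norm M))// ltrDl.
Qed.

Section transforms.
Context {R : realType}.
Implicit Type mu : {measure set (measurableTypeR R) -> \bar R}.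

Definition Cintegral mu (f : R -> R[i]) : R[i] :=
  (\int[mu]_x complex.Re (f x)) +i* (\int[mu]_x complex.Im (f x)).

Definition cauchy_transform mu (z : R[i]) : R[i] :=
  Cintegral mu (fun x => (z - x%:C)^-1).

Definition F_transform mu (z : R[i]) : R[i] := (cauchy_transform mu z)^-1.

(* K is a right inverse of F near infinity, with values in a neighbourhood of
   infinity on which F is one-to-one.  This determines K near infinity: given
   two such pairs (r1, K1) and (r2, K2) with r1 <= r2, both K1 and K2 eventually
   take values in {w : r1 < |w|}, where F is injective. *)
Definition right_inverse_at_infinity (F K : R[i] -> R[i]) : Prop :=
  exists r : R,
    (forall z w, r < normc z -> r < normc w -> F z = F w -> z = w) /\
    (\forall z \near cinfty R, r < normc (K z) /\ F (K z) = z).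

(* Only the germ at infinity is meaningful; if there were no right inverse, the
   chosen function would be constantly 0. *)
Definition inverse_at_infinity (F : R[i] -> R[i]) : R[i] -> R[i] :=
  xget (cst 0) [set K | right_inverse_at_infinity F K].

Definition voiculescu_transform mu (z : R[i]) : R[i] :=
  inverse_at_infinity (F_transform mu) z - z.

Definition msupport mu : set R :=
  [set x | forall U : set R, open U -> U x -> (0 < mu U)%E].

(* omega 0 is not used, as the polynomial of index -1 is 0. *)
Definition jacobi_szego mu (alpha omega : nat -> R) : Prop :=
  (forall n, mu.-integrable setT (fun x : R => (x ^+ n)%:E)) /\
  exists P : nat -> {poly R},
    [/\ forall n, P n \is monic /\ size (P n) = n.+1,
        forall m n, m != n -> \int[mu]_x ((P m).[x] * (P n).[x]) = 0 &
        forall n, 'X * P n = P n.+1 + alpha n *: P n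
                             + omega n *: (if n is k.+1 then P k else 0)].

Definition free_meixner (a b : R) mu : Prop :=
  compact (msupport mu) /\
  jacobi_szego mu (fun n => if n == 0%N then 0 else a)
                  (fun n => if n == 1%N then 1 else 1 + b).

End transforms.

Section semicircle.
Context {R : realType}.
Variables a b : R.

Definition semicircle_pdf (x : R) : R :=
  Num.sqrt (4 * b - (x - a) ^+ 2) / (2 * pi * b).

Definition semicircle_itv : set R :=
  `[a - 2 * Num.sqrt b, a + 2 * Num.sqrt b]%classic.

(* For b < 0 this is the zero measure. *)
Definition semicircle_law : set (measurableTypeR R) -> \bar R := fun A =>
  if b == 0 then \d_a A
  else (\int[lebesgue_measure]_(x in A `&` semicircle_itv) (semicircle_pdf x)%:E)%E.

Let semicircle_pdf_ge0 x : 0 <= semicircle_pdf x.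
Proof.
rewrite /semicircle_pdf; have [b0|b0] := leP 0 b.
  by rewrite divr_ge0 ?mulr_ge0 ?sqrtr_ge0 ?pi_ge0.
rewrite ler0_sqrtr ?mul0r// subr_le0 (@le_trans _ _ 0) ?sqr_ge0//.
by rewrite pmulr_rle0 ?ltW.
Qed.

Let measurable_semicircle_pdf : measurable_fun [set: R] semicircle_pdf.
Proof.
apply: measurable_funM => //.
apply: measurableT_comp.
  by apply: continuous_measurable_fun; exact: sqrt_continuous.
by apply: measurable_funB => //; apply: measurable_funX; apply: measurable_funB.
Qed.

Let semicircle_law0 : semicircle_law set0 = 0%E.
Proof.
by rewrite /semicircle_law set0I integral_set0 measure0 if_same.
Qed.

Let semicircle_law_ge0 A : (0 <= semicircle_law A)%E.
Proof.
rewrite /semicircle_law; case: ifP => // _.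
by apply: integral_ge0 => x _; rewrite lee_fin.
Qed.

Let semicircle_law_sigma_additive : semi_sigma_additive semicircle_law.
Proof.
rewrite /semicircle_law; case: (b == 0).
  exact: (@measure_semi_sigma_additive _ _ _ \d_a).
move=> F mF tF mUF; rewrite setI_bigcupl.
rewrite (@ge0_integral_bigcup _ _ _ _ (fun n => F n `&` semicircle_itv)).
- apply: is_cvg_ereal_nneg_natsum_cond => n _ _.
  by apply: integral_ge0 => x _; rewrite lee_fin.
- by move=> n; apply: measurableI => //; exact: measurable_itv.
- exact/measurable_EFinP/measurable_funTS.
- by move=> x _; rewrite lee_fin.
- exact: trivIset_setIr.
Qed.

HB.instance Definition _ := isMeasure.Build _ _ _
  semicircle_law semicircle_law0 semicircle_law_ge0 semicircle_law_sigma_additive.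

End semicircle.

Definition meixner_g {R : realType} (a b : R) (z : R[i]) : R[i] :=
  z / (1 + a%:C * z + b%:C * z ^+ 2).

(* Main.v *)
Require Import Defs.
From HB Require Import structures.
From mathcomp Require Import all_boot all_order all_algebra.
From mathcomp Require Import all_classical all_reals all_analysis.
From mathcomp Require Import complex.
From mathcomp Require Import measurable_realfun ring lra.

Import Order.TTheory GRing.Theory Num.Theory.
Import numFieldNormedType.Exports.

Local Open Scope classical_set_scope.
Local Open Scope ring_scope.

(** Both parts come down to one algebraic fact.  Let S be the Cauchy transform
    of the semicircle law of mean a and variance 1 + b.  Near infinity S(z) is
    the small root s of

      (1 + b) s^2 - (z - a) s + 1 = 0,

    the other root being of the order of z, and the free Meixner law satisfies
    G_mu(z) = 1 / (z - S(z)): this is its continued fraction, whose tail after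
    the first level is that of the semicircle law.

    Both statements about Cauchy transforms are instances of
    [cauchy_transform_of_recurrence].  If monic polynomials P_n satisfy a
    three-term recurrence and have mean 0 for n > 0, then the functions of the
    second kind Q_n(z), the integrals of P_n(x) / (z - x), satisfy the same
    recurrence in z, up to a term 1 at n = 0.  Where the coefficients are
    constant, the solutions of this recurrence are combinations of the powers
    of a small and of a large root.  As P_n grows at most like K^n on a compact
    carrier, the large root cannot occur once it exceeds K
    ([recessive_solution]), so Q_(n+1) / Q_n is known, and going down to n = 0
    gives Q_0 = G_mu.  For the semicircle law the polynomials are rescaled
    Chebyshev polynomials of the second kind, whose means are computed with the
    substitution x = a + 2 sqrt(b) cos t.

    Hence F_mu(z) = z - S(z).  Put T for the Cauchy transform of the semicircle
    law of mean a and variance b >= 0.  The quadratic equation of T(y) says that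
    T(y) is the small root of the equation of S at the point K(y) = y + T(y).
    So S(K(y)) = T(y) and F_mu(K(y)) = y.  In the same way, eliminating z
    between f = z - s and the equation of s leaves b s^2 - (f - a) s + 1 = 0;
    its small root is unique, so F_mu is one-to-one near infinity.  Therefore K
    is the right inverse of F_mu and phi_mu = T, which is (i).

    If b < 0, then (i) applied to eta gives phi_eta = S, and the equation of S
    reads 1 + a S + b S^2 = S (z - S), that is g(S) = 1 / (z - S) = G_mu. *)

Section free_meixner.
Set Implicit Arguments.
Unset Strict Implicit.
Unset Printing Implicit Defensive.
Context {R : realType}.
Local Notation C := R[i].
Local Notation leb := (@lebesgue_measure R).
Import Normc.
Local Open Scope complex_scope.

(** * Complex norm and quadratic equations *)

Lemma normc_ge0 (z : C) : 0 <= normc z.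
Proof. by case: z => x y; exact: sqrtr_ge0. Qed.

Lemma normc_real (x : R) : normc x%:C = `|x|.
Proof. by rewrite /normc /= expr0n addr0 sqrtr_sqr. Qed.

Lemma normcX (z : C) n : normc (z ^+ n) = normc z ^+ n.
Proof.
by elim: n => [|n IH]; rewrite ?normc1// !exprS normcM IH.
Qed.

Lemma normc_eq0 (z : C) : (normc z == 0) = (z == 0).
Proof. by apply/eqP/eqP => [/eq0_normc//|->]; exact: normc0. Qed.

Lemma le_normcB (z w : C) : normc z - normc w <= normc (z - w).
Proof. by rewrite lerBlDr (le_trans _ (le_normcD _ _))// subrK. Qed.

Lemma Re_le_normc (z : C) : `|complex.Re z| <= normc z.
Proof.
case: z => x y /=; rewrite -sqrtr_sqr ler_wsqrtr// lerDl; exact: sqr_ge0.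
Qed.

Lemma Im_le_normc (z : C) : `|complex.Im z| <= normc z.
Proof.
case: z => x y /=; rewrite -sqrtr_sqr ler_wsqrtr// lerDr; exact: sqr_ge0.
Qed.

Lemma normc_le_ReIm (z : C) : normc z <= `|complex.Re z| + `|complex.Im z|.
Proof.
have -> : z = (complex.Re z)%:C + 'i * (complex.Im z)%:C.
  by rewrite -complexE.
apply: (le_trans (le_normcD _ _)); rewrite normcM !normc_real /=.
rewrite expr0n/= expr1n add0r sqrtr1 mul1r.
by rewrite !mul0r mulr0 mul1r subr0 addr0 !add0r.
Qed.

Lemma le0_of_geometric (x B q : R) : 0 <= q < 1 ->
  (forall n, x <= B * q ^+ n) -> x <= 0.
Proof.
move=> /andP[q0 q1] xB.
have qn0 : (q ^+ n @[n --> \oo] --> (0 : R))%classic.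
  by apply: cvg_expr; rewrite ger0_norm.
have cB : (B * q ^+ n @[n --> \oo] --> B * 0)%classic.
  by apply: cvgM => //; exact: cvg_cst.
rewrite mulr0 in cB; rewrite -(cvg_lim _ cB)//.
apply: limr_ge; first by apply/cvg_ex; exists 0.
by apply: nearW => n.
Qed.

(** The characteristic roots of the recurrence are c s and 1 / s. The
    combination [x n.+1 - c * s * x n] removes the first one, so it is
    multiplied by 1 / s at each step, which is faster than K^n; hence it
    vanishes. *)
Lemma recessive_solution (c w s : C) (K B : R) (x : nat -> C) :
  0 <= K -> c * s ^+ 2 - w * s + 1 = 0 -> K * normc s < 1 ->
  (forall n, x n.+2 = w * x n.+1 - c * x n) ->
  (forall n, normc (x n) <= B * K ^+ n) ->
  x 1%N = c * s * x 0%N.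
Proof.
move=> K0 sE Ks xS xK.
pose D n := x n.+1 - c * s * x n.
have DE n : D 0%N = s ^+ n * D n.
  elim: n => [|n ->]; first by rewrite mul1r.
  rewrite exprSr -mulrA; congr (_ * _); rewrite /D xS.
  apply/eqP; rewrite -subr_eq0; apply/eqP.
  have -> : x n.+1 - c * s * x n - s * (w * x n.+1 - c * x n - c * s * x n.+1)
      = (c * s ^+ 2 - w * s + 1) * x n.+1 by ring.
  by rewrite sE mul0r.
suff : normc (D 0%N) <= 0.
  move=> h; apply/eqP; rewrite -subr_eq0 -normc_eq0.
  by apply/eqP/le_anti; rewrite h normc_ge0.
apply: (@le0_of_geometric _ (B * K + normc (c * s) * B) (K * normc s)).
  by rewrite Ks mulr_ge0// normc_ge0.
move=> n; rewrite (DE n) normcM normcX exprMn mulrA mulrC ler_wpM2r//.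
  by rewrite exprn_ge0// normc_ge0.
rewrite mulrDl -mulrA -exprS -mulrA; apply: (le_trans (le_normcD _ _)).
by rewrite normcN lerD// normcM ler_wpM2l// normc_ge0.
Qed.

(** Distinct roots s and t satisfy c (s + t) = w, which fails if both are small. *)
Lemma small_root_unique (c w s t : C) :
  c * s ^+ 2 - w * s + 1 = 0 -> c * t ^+ 2 - w * t + 1 = 0 ->
  normc c * (normc s + normc t) < normc w -> s = t.
Proof.
move=> sE tE small; apply/eqP; rewrite -subr_eq0.
have : (s - t) * (c * (s + t) - w) = 0.
  have -> : (s - t) * (c * (s + t) - w) =
     (c * s ^+ 2 - w * s + 1) - (c * t ^+ 2 - w * t + 1) by ring.
  by rewrite sE tE subr0.
move/eqP; rewrite mulf_eq0 => /orP[//|]; rewrite (subr_eq0 (_ * _)) => /eqP wE.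
move: small; rewrite -wE normcM ltNge ler_wpM2l// ?normc_ge0//.
exact: le_normcD.
Qed.

(** The inverse 1 / s is a root of y^2 - w y + c.  The two roots of this
    polynomial add up to w, so one of them has norm at least that of w / 2. *)
Lemma small_root_exists (c w : C) : w != 0 ->
  exists2 s, c * s ^+ 2 - w * s + 1 = 0 & normc s <= 2 / normc w.
Proof.
move=> w0.
have [|y yE] := @solve_monicpoly C 2 (fun i => if i == 0%N then - c else w).
  by [].
move: yE; rewrite !big_ord_recl big_ord0 /= expr0 mulr1 expr1 addr0 => yE.
have w0' : 0 < normc w by rewrite lt_def normc_ge0 normc_eq0 w0.
have key v : v ^+ 2 = - c + w * v -> normc w / 2 <= normc v ->
    exists2 s, c * s ^+ 2 - w * s + 1 = 0 & normc s <= 2 / normc w.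
  move=> vE v2.
  have v0' : 0 < normc v by apply: lt_le_trans v2; rewrite divr_gt0.
  have v0 : v != 0 by rewrite -normc_eq0 gt_eqF.
  exists v^-1.
    have -> : c * v^-1 ^+ 2 - w * v^-1 + 1 = (c - w * v + v ^+ 2) / v ^+ 2.
      by field.
    by rewrite vE addrACA subrr addNr addr0 mul0r.
  rewrite normcV -[leRHS]invf_div lef_pV2//.
  by rewrite posrE divr_gt0.
have [|] := leP (normc w / 2) (normc y); first exact: key.
move=> yw; apply: (key (w - y)); last first.
  by apply: le_trans (le_normcB _ _); lra.
have -> : - c + w * (w - y) = (w - y) ^+ 2 + ((- c + w * y) - y ^+ 2) by ring.
by rewrite -yE subrr addr0.
Qed.

(** * Functions of the second kind *)

(** The class of integrands used with a measure carried by [-M, M].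
    Measurability is required everywhere and boundedness only on the carrier,
    because x |-> 1 / (z - x) is unbounded on the line when z is real. *)
Definition measurable_bounded (M : R) (f : R -> R) : Prop :=
  measurable_fun [set: R] f /\
  exists B, forall x, `|x| <= M -> `|f x| <= B.

Section bounded_integrands.
Variable M : R.
Implicit Types f g : R -> R.

Lemma measurable_bounded_horner (p : {poly R}) :
  measurable_bounded M (horner p).
Proof.
split; first exact: measurable_poly.
elim/poly_ind: p => [|p c [B Bp]].
  by exists 0 => x _; rewrite horner0 normr0.
exists (B * `|M| + `|c|) => x xM.
rewrite !hornerE (le_trans (ler_normD _ _))// lerD2r normrM.
by rewrite ler_pM// ?Bp// (le_trans xM)// ler_norm.
Qed.

Lemma measurable_boundedD f g : measurable_bounded M f ->
  measurable_bounded M g -> measurable_bounded M (fun x => f x + g x).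
Proof.
move=> [mf [B fB]] [mg [D gD]]; split; first exact: measurable_funD.
exists (B + D) => x xM; rewrite (le_trans (ler_normD _ _))// lerD//.
- exact: fB.
- exact: gD.
Qed.

Lemma measurable_boundedB f g : measurable_bounded M f ->
  measurable_bounded M g -> measurable_bounded M (fun x => f x - g x).
Proof.
move=> [mf [B fB]] [mg [D gD]]; split; first exact: measurable_funB.
exists (B + D) => x xM; rewrite (le_trans (ler_normB _ _))// lerD//.
- exact: fB.
- exact: gD.
Qed.

Lemma measurable_boundedM f g : measurable_bounded M f ->
  measurable_bounded M g -> measurable_bounded M (fun x => f x * g x).
Proof.
move=> [mf [B fB]] [mg [D gD]]; split; first exact: measurable_funM.
by exists (B * D) => x xM; rewrite normrM ler_pM// ?fB// gD.
Qed.

(** On nonnegative reals the inverse is the power of exponent -1. *)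
Lemma measurable_funV_ge0 (f : R -> R) : measurable_fun [set: R] f ->
  (forall x, 0 <= f x) -> measurable_fun [set: R] (fun x => (f x)^-1).
Proof.
move=> mf f0; under eq_fun do rewrite -powR_inv1//.
exact: (measurableT_comp (measurable_powR (-1))).
Qed.

(** The common denominator of the real and imaginary parts of 1 / (z - x). *)
Lemma measurable_resolvent_normsq (z : C) : measurable_fun [set: R]
  (fun x : R => ((complex.Re z - x) ^+ 2 + complex.Im z ^+ 2)^-1).
Proof.
apply: measurable_funV_ge0 => [|x]; last by rewrite addr_ge0// sqr_ge0.
apply: measurable_funD => //; apply: measurable_funX.
exact: measurable_funB.
Qed.

Lemma normc_resolvent (z : C) (x : R) : M + 1 < normc z -> `|x| <= M ->
  normc (z - x%:C)^-1 <= 1.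
Proof.
move=> Mz xM; rewrite normcV invf_le1.
  by apply: le_trans (le_normcB _ _); rewrite normc_real; lra.
by apply: lt_le_trans (le_normcB _ _); rewrite normc_real; lra.
Qed.

Lemma measurable_bounded_Re_resolvent (z : C) : M + 1 < normc z ->
  measurable_bounded M (fun x => complex.Re (z - x%:C)^-1).
Proof.
move=> Mz; split.
  have := measurable_resolvent_normsq z; case: z Mz => u v Mz /= mq.
  under eq_fun do rewrite subr0; apply: measurable_funM => //.
  exact: measurable_funB.
exists 1 => x xM; apply: le_trans (Re_le_normc _) _; exact: normc_resolvent.
Qed.

Lemma measurable_bounded_Im_resolvent (z : C) : M + 1 < normc z ->
  measurable_bounded M (fun x => complex.Im (z - x%:C)^-1).
Proof.
move=> Mz; split.
  have := measurable_resolvent_normsq z; case: z Mz => u v Mz /= mq.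
  under eq_fun do rewrite subr0; apply: measurableT_comp => //.
  exact: measurable_funM.
exists 1 => x xM; apply: le_trans (Im_le_normc _) _; exact: normc_resolvent.
Qed.
End bounded_integrands.

Section carrier.
Variables (mu : {measure set (measurableTypeR R) -> \bar R}) (M : R).
Hypotheses (mu1 : mu setT = 1%E) (muM : mu (~` `[-M, M]%classic) = 0%E).
Implicit Types f g : R -> R.

Let inI (x : R) : (`[-M, M]%classic x) = (`|x| <= M).
Proof. by rewrite /= in_itv/= ler_norml. Qed.

Let muI : mu `[-M, M]%classic = 1%E.
Proof.
pose I : set (measurableTypeR R) := `[-M, M]%classic.
have muU : mu (I `|` ~` I) = (mu I + mu (~` I))%E.
  have mI : measurable I by exact: measurable_itv.
  by rewrite measureU//; [exact: measurableC|exact: setICr].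
by move: muU; rewrite setUv mu1 muM adde0.
Qed.

Let integrableI f : measurable_bounded M f ->
  mu.-integrable `[-M, M]%classic (EFin \o f).
Proof.
move=> [mf [B fB]]; apply: measurable_bounded_integrable => //.
- by rewrite muI ltry.
- exact: measurable_funTS.
- exists B; split; first by rewrite num_real.
  move=> b Bb x; rewrite inI => xM; exact: le_trans (fB _ xM) (ltW Bb).
Qed.

Lemma carrier_integrable f : measurable_bounded M f ->
  mu.-integrable setT (EFin \o f).
Proof.
move=> mf; apply/(@negligible_integrable _ _ _ mu setT (~` `[-M, M]%classic)).
- exact: measurableC.
- by [].
- by apply/measurable_EFinP; case: mf.
- exact: muM.
- by rewrite setTD setCK; exact: integrableI.
Qed.

Lemma carrier_Rintegral f : measurable_bounded M f ->
  \int[mu]_x f x = \int[mu]_(x in `[-M, M]) f x.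
Proof.
move=> mf; rewrite /Rintegral; congr fine.
rewrite (@negligible_integral _ _ _ mu setT (~` `[-M, M]%classic)).
- by rewrite setTD setCK.
- exact: measurableC.
- by [].
- exact: carrier_integrable.
- exact: muM.
Qed.

Lemma carrier_eq_Rintegral f g :
  measurable_bounded M f -> measurable_bounded M g ->
  (forall x, `|x| <= M -> f x = g x) -> \int[mu]_x f x = \int[mu]_x g x.
Proof.
move=> mf mg fg; rewrite !carrier_Rintegral//; apply: eq_Rintegral => x.
by rewrite inE inI => /fg.
Qed.

Lemma carrier_le_Rintegral f B : measurable_bounded M f ->
  (forall x, `|x| <= M -> `|f x| <= B) -> `|\int[mu]_x f x| <= B.
Proof.
move=> mf fB; rewrite carrier_Rintegral//.
apply: le_trans; first by apply: le_normr_Rintegral => //; exact: integrableI.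
apply: (@le_trans _ _ (\int[mu]_(x in `[-M, M]) B)).
  apply: le_Rintegral => //.
  - apply: integrableI; case: mf => mf _; split.
      exact: measurableT_comp.
    by exists B => x /fB; rewrite normr_id.
  - by apply: integrableI; split=> //; exists `|B|.
  - by move=> x; rewrite inI => /fB.
by rewrite Rintegral_cst// muI mulr1.
Qed.

Definition second_kind (p : {poly R}) (z : C) : C :=
  Cintegral mu (fun x => p.[x]%:C * (z - x%:C)^-1).

Let ReM (r : R) (w : C) : complex.Re (r%:C * w) = r * complex.Re w.
Proof. by case: w => a b /=; rewrite mul0r subr0. Qed.
Let ImM (r : R) (w : C) : complex.Im (r%:C * w) = r * complex.Im w.
Proof. by case: w => a b /=; rewrite mul0r addr0. Qed.

Lemma second_kindE p z : second_kind p z =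
  (\int[mu]_x (p.[x] * complex.Re (z - x%:C)^-1)) +i*
  (\int[mu]_x (p.[x] * complex.Im (z - x%:C)^-1)).
Proof.
by rewrite /second_kind /Cintegral; congr (_ +i* _);
  apply: eq_Rintegral => x _; rewrite ?ReM ?ImM.
Qed.

Lemma second_kind1 z : second_kind 1 z = cauchy_transform mu z.
Proof.
rewrite /second_kind /cauchy_transform; congr (Cintegral mu).
by apply/funext => x; rewrite hornerC mul1r.
Qed.

Section resolvent.
Variable z : C.
Hypothesis Mz : M + 1 < normc z.

Let bRe p : measurable_bounded M (fun x => p.[x] * complex.Re (z - x%:C)^-1).
Proof.
apply: measurable_boundedM; first exact: measurable_bounded_horner.
exact: measurable_bounded_Re_resolvent.
Qed.

Let bIm p : measurable_bounded M (fun x => p.[x] * complex.Im (z - x%:C)^-1).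
Proof.
apply: measurable_boundedM; first exact: measurable_bounded_horner.
exact: measurable_bounded_Im_resolvent.
Qed.

Lemma second_kindD p q :
  second_kind (p + q) z = second_kind p z + second_kind q z.
Proof.
rewrite !second_kindE /=; congr (_ +i* _).
- rewrite -RintegralD//; [|exact: carrier_integrable (bRe _)..].
  by apply: eq_Rintegral => x _; rewrite hornerD mulrDl.
- rewrite -RintegralD//; [|exact: carrier_integrable (bIm _)..].
  by apply: eq_Rintegral => x _; rewrite hornerD mulrDl.
Qed.

Lemma second_kindZ a p : second_kind (a *: p) z = a%:C * second_kind p z.
Proof.
rewrite !second_kindE; apply/eqP; rewrite eq_complex /= !mul0r subr0 addr0.
apply/andP; split; apply/eqP.
- rewrite -RintegralZl//; last exact: carrier_integrable (bRe _).
  by apply: eq_Rintegral => x _; rewrite hornerZ mulrA.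
- rewrite -RintegralZl//; last exact: carrier_integrable (bIm _).
  by apply: eq_Rintegral => x _; rewrite hornerZ mulrA.
Qed.

(** Integrate x p(x) / (z - x) = z p(x) / (z - x) - p(x). This holds only on
    the carrier: when z is real it fails at x = z. *)
Lemma second_kind_mulX p : second_kind ('X * p) z =
  z * second_kind p z - (\int[mu]_x p.[x])%:C.
Proof.
have resolventE (x : R) : `|x| <= M ->
    x%:C * (z - x%:C)^-1 = z * (z - x%:C)^-1 - 1.
  move=> xM; have zx : z - x%:C != 0.
    rewrite -normc_eq0 gt_eqF// (lt_le_trans _ (le_normcB _ _))// normc_real.
    by rewrite subr_gt0 (le_lt_trans xM)// (lt_trans _ Mz)// ltrDl.
  by field.
have ip := carrier_integrable (measurable_bounded_horner M p).
have iR := carrier_integrable (bRe p); have iI := carrier_integrable (bIm p).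
rewrite !second_kindE.
have -> : z * ((\int[mu]_x (p.[x] * complex.Re (z - x%:C)^-1)) +i*
      (\int[mu]_x (p.[x] * complex.Im (z - x%:C)^-1)))
      - (\int[mu]_x p.[x])%:C =
    (complex.Re z * (\int[mu]_x (p.[x] * complex.Re (z - x%:C)^-1))
      - complex.Im z * (\int[mu]_x (p.[x] * complex.Im (z - x%:C)^-1))
      - \int[mu]_x p.[x]) +i*
    (complex.Re z * (\int[mu]_x (p.[x] * complex.Im (z - x%:C)^-1))
      + complex.Im z * (\int[mu]_x (p.[x] * complex.Re (z - x%:C)^-1))).
  by case: (z) => u v; apply/eqP; rewrite eq_complex /= oppr0 !addr0 !eqxx.
have bZ (k : R) f : measurable_bounded M f ->
    measurable_bounded M (fun x => k * f x).
  move=> [mf [D fD]]; split; first exact: measurable_funM.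
  by exists (`|k| * D) => x xM; rewrite normrM ler_wpM2l// fD.
have bR := bRe p; have bI := bIm p.
congr (_ +i* _).
- rewrite -!RintegralZl// -!RintegralB//.
  + apply: carrier_eq_Rintegral; first exact: bRe.
    * apply: measurable_boundedB; last exact: measurable_bounded_horner.
      by apply: measurable_boundedB; exact: bZ.
    * move=> x xM; rewrite hornerM hornerX.
      rewrite [x * _]mulrC -mulrA -ReM resolventE//; case: (z) => u v.
      by case: ((u +i* v - x%:C)^-1) => s t /=; ring.
  + exact: carrier_integrable (measurable_boundedB (bZ _ _ bR) (bZ _ _ bI)).
  + exact: carrier_integrable (bZ _ _ bR).
  + exact: carrier_integrable (bZ _ _ bI).
- rewrite -!RintegralZl// -!RintegralD//.
  + apply: carrier_eq_Rintegral; first exact: bIm.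
    * apply: measurable_boundedD => //; exact: bZ.
    * move=> x xM; rewrite hornerM hornerX.
      rewrite [x * _]mulrC -mulrA -ImM resolventE//; case: (z) => u v.
      by case: ((u +i* v - x%:C)^-1) => s t /=; ring.
  + exact: carrier_integrable (bZ _ _ bI).
  + exact: carrier_integrable (bZ _ _ bR).
Qed.

Lemma second_kind_le p B : (forall x, `|x| <= M -> `|p.[x]| <= B) ->
  normc (second_kind p z) <= 2 * B.
Proof.
move=> pB; apply: le_trans (normc_le_ReIm _) _.
have pB' (g : R -> R) x : `|x| <= M -> `|g x| <= 1 -> `|p.[x] * g x| <= B.
  by move=> xM g1; rewrite normrM -[B]mulr1 ler_pM// pB.
rewrite second_kindE /= -[2]/(1 + 1) mulrDl mul1r; apply: lerD.
- apply: carrier_le_Rintegral => [|x xM]; first exact: bRe.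
  apply: (pB' (fun x => complex.Re (z - x%:C)^-1)) => //.
  apply: le_trans (Re_le_normc _) _; exact: (normc_resolvent Mz).
- apply: carrier_le_Rintegral => [|x xM]; first exact: bIm.
  apply: (pB' (fun x => complex.Im (z - x%:C)^-1)) => //.
  apply: le_trans (Im_le_normc _) _; exact: (normc_resolvent Mz).
Qed.
End resolvent.

(** The recurrence with alpha_n = a for n > 0 and omega_n = c for n > 1, while
    alpha_0 and omega_1 are free. *)
Definition eventually_constant_recurrence (alpha0 omega1 a c : R)
    (P : nat -> {poly R}) : Prop :=
  [/\ P 0%N = 1, 'X * P 0%N = P 1%N + alpha0 *: P 0%N,
      'X * P 1%N = P 2 + a *: P 1%N + omega1 *: P 0%N &
      forall n, 'X * P n.+2 = P n.+3 + a *: P n.+2 + c *: P n.+1].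

Lemma recurrence_bound (P : nat -> {poly R}) alpha0 omega1 a c :
  eventually_constant_recurrence alpha0 omega1 a c P ->
  exists2 K, 0 <= K & forall n x, `|x| <= M -> `|(P n).[x]| <= K ^+ n.
Proof.
move=> [P0 P1 P2 PS].
pose K := 1 + (`|M| + `|alpha0| + `|a| + `|omega1| + `|c|).
have [nM n0 na n1 nc] : [/\ 0 <= `|M|, 0 <= `|alpha0|, 0 <= `|a|,
  0 <= `|omega1| & 0 <= `|c|] by split.
have K1 : 1 <= K by rewrite /K; lra.
have K0 : 0 <= K by apply: le_trans K1.
exists K => // n x xM.
have xM' : `|x| <= `|M| by apply: le_trans xM (ler_norm _).
have p0 : `|(P 0%N).[x]| <= 1 by rewrite P0 hornerC normr1.
have step (p q r : {poly R}) (k l B : R) : 'X * p = r + k *: p + l *: q ->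
    `|p.[x]| <= B -> `|q.[x]| <= B ->
    `|M| + `|k| + `|l| <= K -> `|r.[x]| <= K * B.
  move=> pE pB qB kl.
  have -> : r.[x] = x * p.[x] - k * p.[x] - l * q.[x].
    have := congr1 (fun s => s.[x]) pE.
    by rewrite /= hornerM hornerX !hornerD !hornerZ => ->; ring.
  have B0 : 0 <= B by apply: le_trans pB.
  apply: (@le_trans _ _ ((`|M| + `|k| + `|l|) * B)); last by rewrite ler_wpM2r.
  rewrite !mulrDl; apply: le_trans (ler_normB _ _) _; apply: lerD.
    apply: le_trans (ler_normB _ _) _; rewrite !normrM.
    by apply: lerD; apply: ler_pM.
  by rewrite normrM ler_pM.
suff : `|(P n).[x]| <= K ^+ n /\ `|(P n.+1).[x]| <= K ^+ n.+1 by case.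
elim: n => [|n [IH1 IH2]].
  split => //; rewrite expr1 -[K]mulr1.
  apply: (step (P 0%N) 0 _ alpha0 0) => //.
  - by rewrite scaler0 addr0.
  - by rewrite horner0 normr0.
  - by rewrite normr0 /K; lra.
have IH : `|(P n).[x]| <= K ^+ n.+1.
  by rewrite (le_trans IH1)// exprS ler_peMl// exprn_ge0.
split => //; rewrite exprS.
case: n {IH1} IH2 IH => [|n] IH2 IH.
- by apply: (step _ _ _ _ _ _ P2) => //; rewrite /K; lra.
- by apply: (step _ _ _ _ _ _ (PS n)) => //; rewrite /K; lra.
Qed.

(** By [recessive_solution] applied from n = 1 on, Q_2 = c s Q_1. The
    recurrence at n = 1 and the equation of s turn this into Q_1 = omega_1 s
    Q_0, and the recurrence at n = 0 is z Q_0 - 1 = Q_1 + alpha_0 Q_0. The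
    bound on s is the one that the small root satisfies as soon as z has norm
    at least 2 |a|. *)
Lemma cauchy_transform_of_recurrence (P : nat -> {poly R}) alpha0 omega1 a c :
  eventually_constant_recurrence alpha0 omega1 a c P ->
  (forall n, \int[mu]_x (P n.+1).[x] = 0) ->
  \forall z \near cinfty R, forall s : C,
    c%:C * s ^+ 2 - (z - a%:C) * s + 1 = 0 -> normc s * normc z <= 4 ->
    cauchy_transform mu z * (z - alpha0%:C - omega1%:C * s) = 1.
Proof.
move=> recP intP; have [K K0 PK] := recurrence_bound recP.
case: recP => P0 P1 P2 PS.
(* 4 K < |z| makes K |s| < 1 *)
exists (Num.max (M + 1) (4 * K)) => // z /=.
rewrite gt_max => /andP[Mz Kz] s sE s4.
have z0 : 0 < normc z by apply: le_lt_trans Kz; rewrite mulr_ge0.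
pose Q n := second_kind (P n) z.
have Q1 : z * Q 0%N - 1 = Q 1%N + alpha0%:C * Q 0%N.
  rewrite /Q -second_kindZ// -second_kindD// -P1 second_kind_mulX//.
  congr (_ - _); rewrite P0; under eq_Rintegral do rewrite hornerC.
  by rewrite Rintegral_cst// mu1 mulr1.
have Q2 : z * Q 1%N = Q 2 + a%:C * Q 1%N + omega1%:C * Q 0%N.
  rewrite /Q -!second_kindZ// -!second_kindD// -P2 second_kind_mulX// intP.
  by rewrite subr0.
have QS n : z * Q n.+2 = Q n.+3 + a%:C * Q n.+2 + c%:C * Q n.+1.
  rewrite /Q -!second_kindZ// -!second_kindD// -PS second_kind_mulX// intP.
  by rewrite subr0.
have QE : Q 2 = c%:C * s * Q 1%N.
  apply: (@recessive_solution _ (z - a%:C) _ K (2 * K) (fun n => Q n.+1)) => //.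
  - rewrite -(ltr_pM2r z0) mul1r -mulrA (le_lt_trans _ Kz)// mulrC.
    by rewrite ler_wpM2r.
  - by move=> n; rewrite mulrBl QS; ring.
  - move=> n; rewrite -mulrA -exprS; apply: second_kind_le => // x xM.
    exact: PK.
rewrite -second_kind1 -P0 -/(Q 0%N).
(* multiply the recurrence at n = 1 by s and use s (z - a) = c s^2 + 1 *)
have Q1s : Q 1%N = omega1%:C * s * Q 0%N.
  have : s * (z * Q 1%N) = s * (Q 2 + a%:C * Q 1%N + omega1%:C * Q 0%N).
    by rewrite Q2.
  rewrite QE => h.
  have -> : Q 1%N = (c%:C * s ^+ 2 - (z - a%:C) * s + 1) * Q 1%N
     + (s * (z * Q 1%N) - s * (c%:C * s * Q 1%N + a%:C * Q 1%N)) by ring.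
  by rewrite sE h; ring.
have : z * Q 0%N - alpha0%:C * Q 0%N - Q 1%N = 1.
  transitivity (z * Q 0%N - (Q 1%N + alpha0%:C * Q 0%N)); first by ring.
  by rewrite -Q1; ring.
by rewrite Q1s => <-; ring.
Qed.
End carrier.

(** * The semicircle law *)

Lemma Rintegral_cos (k : nat) :
  \int[leb]_(x in `[0, pi]) cos (k%:R * x) = if k == 0%N then pi else 0.
Proof.
have [->|k0] := eqVneq k 0%N.
  under eq_Rintegral do rewrite mul0r cos0.
  rewrite Rintegral_cst//= lebesgue_measure_itv/= lte_fin pi_gt0/=.
  by rewrite mul1r subr0.
have kN0 : k%:R != 0 :> R by rewrite pnatr_eq0.
have dF (x : R) : is_derive x (1 : R) (fun y : R => sin (k%:R * y) / k%:R)
    (cos (k%:R * x)).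
  apply: is_derive_eq; rewrite /= !(scaler0, add0r, addr0, scale1r).
  by rewrite /GRing.scale /= mulr1 mulrC mulfK.
rewrite /Rintegral (@continuous_FTC2 _ _ (fun y : R => sin (k%:R * y) / k%:R)).
- rewrite mulr0 sin0 mul0r sube0 /=.
  have -> : sin (k%:R * pi) = 0 :> R.
    elim: (k) => [|n IH]; first by rewrite mul0r sin0.
    by rewrite -addn1 natrD mulrDl mul1r sinDpi IH oppr0.
  by rewrite mul0r.
- exact: pi_gt0.
- apply: continuous_subspaceT => x.
  apply: continuous_comp; last exact: continuous_cos.
  apply: cvgM; [exact: cvg_cst|exact: cvg_id].
- have cF : continuous (fun y : R => sin (k%:R * y) / k%:R).
    move=> x; apply: differentiable_continuous; apply/derivable1_diffP.
    by case: (dF x).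
  split => [x _||].
  + by case: (dF x).
  + exact/cvg_at_right_filter/cF.
  + exact/cvg_at_left_filter/cF.
- by move=> x _; rewrite derive1E; case: (dF x).
Qed.

(** By uniqueness, g is almost everywhere the Radon-Nikodym derivative of nu. *)
Lemma integral_density (nu : probability (measurableTypeR R) R) (g f : R -> R) :
  measurable_fun setT g ->
  (forall A, measurable A -> nu A = (\int[leb]_(x in A) (g x)%:E)%E) ->
  nu.-integrable setT (EFin \o f) ->
  (\int[nu]_x (f x)%:E = \int[leb]_x (f x * g x)%:E)%E.
Proof.
move=> mg nuE intf.
have dom : nu `<< leb.
  apply/null_content_dominatesP => A mA A0; rewrite nuE// null_set_integral//.
  by apply/measurable_EFinP; exact: measurable_funTS.
have mf : measurable_fun setT f.
  by apply/measurable_EFinP; exact: measurable_int intf.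
under [RHS]eq_integral do rewrite EFinM.
rewrite -(Radon_Nikodym_change_of_variables dom)//=.
apply: ae_eq_integral => //.
- apply: emeasurable_funM; first exact/measurable_EFinP.
  by apply: (measurable_int leb); exact: Radon_Nikodym_integrable.
- by apply: emeasurable_funM; exact/measurable_EFinP.
- apply: ae_eqe_mul2l => /=.
  rewrite Radon_NikodymE//=; case: cid => /= h [h1 h2 h3].
  apply: integral_ae_eq => //=; first exact/measurable_EFinP.
  by move=> E _ mE; rewrite -h3//= nuE.
Qed.

Section semicircle.
Variables (a b : R).
Hypothesis b0 : 0 < b.
Local Notation r := (Num.sqrt b).

Let r0 : 0 < r. Proof. by rewrite sqrtr_gt0. Qed.
Let rN0 : r != 0. Proof. by rewrite gt_eqF. Qed.
Let piN0 : pi != 0 :> R. Proof. by rewrite gt_eqF// pi_gt0. Qed.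
Let r2 : r ^+ 2 = b. Proof. by rewrite sqr_sqrtr// ltW. Qed.

(** The monic polynomials orthogonal for the semicircle law: with U_n the
    Chebyshev polynomial of the second kind, this is r^n U_n((x - a) / (2 r)). *)
Fixpoint semicircle_poly (n : nat) : {poly R} :=
  if n is m.+1 then
    if m is k.+1 then
      ('X - a%:P) * semicircle_poly m - b *: semicircle_poly k
    else 'X - a%:P
  else 1.

Lemma semicircle_polyS n : semicircle_poly n.+2 =
  ('X - a%:P) * semicircle_poly n.+1 - b *: semicircle_poly n.
Proof. by []. Qed.

Lemma semicircle_poly_recurrence :
  eventually_constant_recurrence a b a b semicircle_poly.
Proof.
split => //=.
- by rewrite mulr1 alg_polyC subrK.
- by rewrite mulrBl mul_polyC; ring.
- move=> n; rewrite -!semicircle_polyS [in RHS]semicircle_polyS.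
  by rewrite mulrBl mul_polyC; ring.
Qed.

Lemma semicircle_poly_sin n (t : R) :
  (semicircle_poly n).[a + 2 * r * cos t] * sin t =
  r ^+ n * sin (n.+1%:R * t).
Proof.
suff [] : (semicircle_poly n).[a + 2 * r * cos t] * sin t =
  r ^+ n * sin (n.+1%:R * t) /\
  (semicircle_poly n.+1).[a + 2 * r * cos t] * sin t =
  r ^+ n.+1 * sin (n.+2%:R * t) by [].
elim: n => [|n [IH1 IH2]]; split => //.
- by rewrite hornerC !mul1r.
- rewrite /= hornerXsubC expr1 (_ : 2%:R * t = t + t) ?sinD; ring.
set x := a + _ in IH1 IH2 *.
have -> : (semicircle_poly n.+2).[x] * sin t =
    (x - a) * ((semicircle_poly n.+1).[x] * sin t)
    - b * ((semicircle_poly n).[x] * sin t).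
  by rewrite semicircle_polyS hornerD hornerN hornerZ hornerM hornerXsubC; ring.
rewrite IH1 IH2 /x.
have -> : n.+3%:R * t = n.+2%:R * t + t.
  by rewrite -[n.+3]addn1 natrD mulrDl mul1r.
have -> : n.+1%:R * t = n.+2%:R * t - t.
  by rewrite -[n.+2]addn1 natrD mulrDl mul1r addrK.
rewrite -[X in _ - X * _ = _]r2 sinB [in RHS]sinD !exprS; ring.
Qed.

(** The substitution that maps [0, pi] onto the support, reversing the order. *)
Let F (t : R) := a + 2 * r * cos t.

Let dF t : is_derive t (1 : R) F (- (2 * r * sin t)).
Proof.
rewrite /F; apply: is_derive_eq; rewrite /= !(scaler0, add0r, addr0).
by rewrite mul1r; exact: mulrN.
Qed.

Lemma semicircle_pdf_cos t : 0 <= t <= pi ->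
  semicircle_pdf a b (F t) = sin t / (pi * r).
Proof.
move=> t0; rewrite /semicircle_pdf /F.
have s0 : 0 <= sin t by rewrite sin_ge0_pi.
have -> : 4 * b - (a + 2 * r * cos t - a) ^+ 2 = (2 * r * sin t) ^+ 2.
  by rewrite -[X in _ * X - _ = _]r2 !exprMn sin2cos2; ring.
rewrite sqrtr_sqr ger0_norm; last by rewrite !mulr_ge0// ltW.
have -> : 2 * pi * b = 2 * pi * r * r by rewrite -[X in _ * X = _]r2; ring.
(* pi is generalized because the field tactic would unfold it *)
by move: piN0; generalize (@pi R) => p pN0; field; rewrite rN0 pN0.
Qed.

Lemma continuous_semicircle_pdf : continuous (semicircle_pdf a b).
Proof.
move=> x; apply: cvgM; last exact: cvg_cst.
apply: (@continuous_comp _ _ _ (fun x => 4 * b - (x - a) ^+ 2) Num.sqrt).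
  apply: cvgB; first exact: cvg_cst.
  have cB : y - a @[y --> x] --> x - a.
    by apply: cvgB; [exact: cvg_id|exact: cvg_cst].
  exact: (cvgM cB cB).
exact: sqrt_continuous.
Qed.

(** With x = F t the integrand becomes a multiple of sin ((n + 1) t) sin t,
    that is of the difference of cos (n t) and cos ((n + 2) t). *)
Lemma Rintegral_semicircle_pdf n :
  \int[leb]_(x in semicircle_itv a b)
    ((semicircle_poly n).[x] * semicircle_pdf a b x) = (n == 0%N)%:R.
Proof.
have -> : semicircle_itv a b = `[F pi, F 0]%classic.
  by rewrite /semicircle_itv /F cospi cos0 mulr1 mulrN1.
have F'E : (F^`())%classic = fun t => - (2 * r * sin t).
  by apply/funext => t; rewrite derive1E; case: (dF t).
have cF' : continuous (F^`())%classic.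
  move=> t; rewrite F'E; apply: cvgN; apply: cvgM; first exact: cvg_cst.
  exact: continuous_sin.
have cF : continuous F.
  move=> t; apply: differentiable_continuous; apply/derivable1_diffP.
  by case: (dF t).
rewrite /Rintegral integration_by_substitution_decreasing//; last first.
- apply: continuous_subspaceT => x.
  by apply: cvgM; [exact: continuous_horner|exact: continuous_semicircle_pdf].
- split => [t _||].
  + by case: (dF t).
  + exact/cvg_at_right_filter/cF.
  + exact/cvg_at_left_filter/cF.
- by apply/cvg_ex; exists (F^`() pi)%classic; apply/cvg_at_left_filter/cF'.
- by apply/cvg_ex; exists (F^`() 0)%classic; apply/cvg_at_right_filter/cF'.
- move=> s t s0 t0 st; rewrite /F ltrD2l ltr_pM2l ?mulr_gt0//.
  by rewrite ltr_cos.
- exact: pi_ge0.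
have fE t : t \in `[0, pi]%classic ->
    (semicircle_poly n).[F t] * semicircle_pdf a b (F t) * - (F^`() t)%classic
    = r ^+ n / pi * (cos (n%:R * t) - cos (n.+2%:R * t)).
  rewrite inE/= in_itv/= => t0; rewrite semicircle_pdf_cos// F'E opprK.
  transitivity ((semicircle_poly n).[F t] * sin t * (2 * sin t) / pi).
    by move: piN0; generalize (@pi R) => p pN0; field; rewrite rN0 pN0.
  rewrite semicircle_poly_sin.
  have -> : n%:R * t = n.+1%:R * t - t.
    by rewrite -[n.+1]addn1 natrD mulrDl mul1r addrK.
  have -> : n.+2%:R * t = n.+1%:R * t + t.
    by rewrite -[n.+2]addn1 natrD mulrDl mul1r.
  rewrite cosB cosD; ring.
have icos k :
    leb.-integrable `[0, pi]%classic (EFin \o (fun t => cos (k%:R * t))).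
  apply: continuous_compact_integrable; first exact: segment_compact.
  apply: continuous_subspaceT => x.
  apply: continuous_comp; last exact: continuous_cos.
  by apply: cvgM; [exact: cvg_cst|exact: cvg_id].
transitivity (\int[leb]_(t in `[0, pi])
    (r ^+ n / pi * (cos (n%:R * t) - cos (n.+2%:R * t)))).
  by congr fine; apply: eq_integral => t t0; rewrite -fE.
rewrite RintegralZl//; last first.
  by apply: (integrableB _ (icos n) (icos n.+2)).
rewrite RintegralB// !Rintegral_cos subr0.
case: n {fE} => [|n] /=; last by rewrite mulr0.
by rewrite expr0 mul1r mulVf.
Qed.

Lemma measurable_semicircle_pdf : measurable_fun setT (semicircle_pdf a b).
Proof. apply: continuous_measurable_fun; exact: continuous_semicircle_pdf. Qed.

(** Outside the support the square root is that of a negative number, which is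
    0; so the law has this density on the whole line. *)
Lemma semicircle_pdf_out x : ~ semicircle_itv a b x -> semicircle_pdf a b x = 0.
Proof.
rewrite /semicircle_itv /= in_itv/= => xI.
rewrite /semicircle_pdf ler0_sqrtr ?mul0r// subr_le0 -[X in _ * X]r2.
have -> : 4 * r ^+ 2 = (2 * r) ^+ 2 by ring.
rewrite -[leRHS]real_normK ?num_real// ler_pXn2r ?nnegrE ?mulr_ge0// leNgt.
by apply/negP => xa; apply: xI; rewrite -ler_distl ltW.
Qed.

Lemma semicircle_lawE A : measurable A ->
  semicircle_law a b A = (\int[leb]_(x in A) (semicircle_pdf a b x)%:E)%E.
Proof.
move=> mA; rewrite /semicircle_law gt_eqF// integral_mkcondr.
apply: eq_integral => x _; rewrite patchE; case: ifPn => //.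
by rewrite notin_setE => /semicircle_pdf_out ->.
Qed.

Lemma semicircle_law_setT : semicircle_law a b setT = 1%E.
Proof.
have ipdf : leb.-integrable (semicircle_itv a b) (EFin \o semicircle_pdf a b).
  apply: continuous_compact_integrable; first exact: segment_compact.
  exact: continuous_subspaceT continuous_semicircle_pdf.
rewrite /semicircle_law gt_eqF// setTI -[LHS]fineK; last first.
  by apply: integrable_fin_num => //; exact: measurable_itv.
congr EFin; rewrite -[RHS](Rintegral_semicircle_pdf 0).
by apply: eq_Rintegral => x _; rewrite /= hornerC mul1r.
Qed.

Lemma semicircle_law_carrier :
  semicircle_law a b (~` `[- (`|a| + 2 * r), `|a| + 2 * r]%classic) = 0%E.
Proof.
rewrite /semicircle_law gt_eqF// [X in integral _ X _](_ : _ = set0).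
  by rewrite integral_set0.
apply/seteqP; split => // x [/= xM].
rewrite /semicircle_itv /= in_itv/= => /andP[x1 x2]; apply: xM.
rewrite in_itv/=.
have := ler_norm a; have := ler_norm (- a); rewrite normrN => ? ?.
by apply/andP; split; lra.
Qed.

Lemma integral_semicircle_law (f : R -> R) :
  (semicircle_law a b).-integrable setT (EFin \o f) ->
  (\int[semicircle_law a b]_x (f x)%:E =
   \int[leb]_x (f x * semicircle_pdf a b x)%:E)%E.
Proof.
pose nu : probability (measurableTypeR R) R :=
  HB.pack (semicircle_law a b)
  (Measure_isProbability.Build _ _ _ (semicircle_law a b) semicircle_law_setT).
apply: (@integral_density nu).
- exact: measurable_semicircle_pdf.
- exact: semicircle_lawE.
Qed.

Lemma Rintegral_semicircle_law_poly n :
  \int[semicircle_law a b]_x (semicircle_poly n).[x] = (n == 0%N)%:R.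
Proof.
rewrite /Rintegral integral_semicircle_law; last first.
  apply: (carrier_integrable semicircle_law_setT semicircle_law_carrier).
  exact: measurable_bounded_horner.
rewrite -Rintegral_semicircle_pdf [in RHS]/Rintegral [in RHS]integral_mkcond.
congr fine; apply: eq_integral => x _; rewrite patchE; case: ifPn => //.
by rewrite notin_setE => /semicircle_pdf_out ->; rewrite mulr0.
Qed.

End semicircle.

Lemma normc_shift_ge (a : R) (z : C) : 2 * `|a| < normc z ->
  normc z / 2 < normc (z - a%:C).
Proof.
move=> az; apply: lt_le_trans (le_normcB _ _); rewrite normc_real; lra.
Qed.

Lemma cauchy_transform_semicircle0 (a : R) (z : C) : `|a| + 1 < normc z ->
  cauchy_transform (semicircle_law a 0) z = (z - a%:C)^-1.
Proof.
move=> az.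
have intE (f : R -> R) : measurable_bounded `|a| f ->
    \int[semicircle_law a 0]_x f x = f a.
  move=> [mf _]; rewrite /Rintegral.
  rewrite (eq_measure_integral (@dirac _ (measurableTypeR R) a R)); last first.
    by move=> A mA _; rewrite /= /semicircle_law; case: eqP.
  rewrite integral_dirac//; last exact/measurable_EFinP.
  by rewrite diracT mul1e.
rewrite /cauchy_transform /Cintegral !intE; first by case: (_^-1).
- exact: measurable_bounded_Im_resolvent.
- exact: measurable_bounded_Re_resolvent.
Qed.

(** For b > 0 the recurrence has alpha_0 = a and omega_1 = b as well, so
    [cauchy_transform_of_recurrence] gives G (z - a - b s) = 1, and s satisfies
    the same equation. The constant 4 is the product of the bound 2 / |z - a|
    of [small_root_exists] with |z| <= 2 |z - a|. *)
Lemma cauchy_transform_semicircle (a b : R) : 0 <= b ->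
  \forall z \near cinfty R, let s := cauchy_transform (semicircle_law a b) z in
    b%:C * s ^+ 2 - (z - a%:C) * s + 1 = 0 /\ normc s * normc z <= 4.
Proof.
rewrite le_eqVlt => /predU1P[<-|b0].
  exists (2 * `|a| + 2) => // z az2.
  rewrite /= in az2.
  have az : 2 * `|a| < normc z by lra.
  have za := normc_shift_ge az.
  have z0 : 0 < normc z by apply: le_lt_trans az; rewrite mulr_ge0.
  have -> : cauchy_transform (semicircle_law a 0) z = (z - a%:C)^-1.
    apply: cauchy_transform_semicircle0; have := normr_ge0 a; lra.
  have za0 : z - a%:C != 0.
    by rewrite -normc_eq0 gt_eqF// (lt_trans _ za)// divr_gt0.
  split; first by field.
  rewrite normcV mulrC ler_pdivrMr; last by rewrite (lt_trans _ za)// divr_gt0.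
  lra.
have := cauchy_transform_of_recurrence (semicircle_law_setT a b0)
  (semicircle_law_carrier a b0) (semicircle_poly_recurrence a b).
have intP n : \int[semicircle_law a b]_x (semicircle_poly a b n.+1).[x] = 0.
  by rewrite Rintegral_semicircle_law_poly.
move=> /(_ intP) [N _ H]; exists (Num.max N (2 * `|a|)) => // z zN.
have /andP[Nz az] : (N < normc z) && (2 * `|a| < normc z) by rewrite -gt_max.
have za := normc_shift_ge az.
have z0 : 0 < normc z by apply: le_lt_trans az; rewrite mulr_ge0.
have za0 : z - a%:C != 0.
  by rewrite -normc_eq0 gt_eqF// (lt_trans _ za)// divr_gt0.
have [s sE s2] := small_root_exists b%:C za0.
have s4 : normc s * normc z <= 4.
  have : normc s * normc (z - a%:C) <= 2.
    by rewrite -ler_pdivlMr// (lt_trans _ za)// divr_gt0.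
  have := normc_ge0 s; nra.
have Gs := H _ Nz _ sE s4.
suff -> : cauchy_transform (semicircle_law a b) z = s by [].
have sK : s * (z - a%:C - b%:C * s) = 1.
  apply/eqP; rewrite -subr_eq0; apply/eqP.
  have -> : s * (z - a%:C - b%:C * s) - 1 =
      - (b%:C * s ^+ 2 - (z - a%:C) * s + 1) by ring.
  by rewrite sE oppr0.
have d0 : z - a%:C - b%:C * s != 0.
  by apply: contra_eq_neq sK => ->; rewrite mulr0 eq_sym oner_neq0.
by apply: (mulIf d0); rewrite Gs sK.
Qed.

(** * Free Meixner distributions *)

(** A point outside the support has a neighbourhood of measure 0, hence also
    one that is an interval with rational endpoints; there are countably many
    of these. *)
Lemma compact_support_carrier
    (mu : {measure set (measurableTypeR R) -> \bar R}) :
  compact (msupport mu) ->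
  exists M : R, mu (~` `[-M, M]%classic) = 0%E.
Proof.
move=> /compact_bounded [M0 [_ HM]].
pose M := M0 + 1; exists M.
have {}HM x : msupport mu x -> `|x| <= M.
  by move=> sx; apply: HM => //; rewrite ltrDl.
pose I (pq : rat * rat) : set R := `]ratr pq.1, ratr pq.2[%classic.
pose F (n : nat) : set (measurableTypeR R) :=
  if unpickle n is Some pq then
    if mu (I pq) == 0%E then I pq else set0
  else set0.
have F0 n : mu.-negligible (F n).
  rewrite /F; case: unpickle => [pq|]; last exact: negligible_set0.
  case: ifPn => [/eqP mu0|_]; last exact: negligible_set0.
  by apply/negligibleP => //; exact: measurable_itv.
apply: measure_negligible; first by apply: measurableC; exact: measurable_itv.
apply: negligibleS (negligible_bigcup F0) => x /= xM.
have /existsNP[U /not_implyP[oU /not_implyP[Ux mU]]] : ~ msupport mu x.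
  by move=> /HM xM'; apply: xM; rewrite in_itv/= -ler_norml.
have mU0 : mu U = 0%E.
  by apply/eqP; rewrite eq_le measure_ge0 andbT leNgt; apply/negP.
have /nbhs_ballP[e /= e0 eU] : nbhs x U by exact: open_nbhs_nbhs.
have [p] := @rat_in_itvoo R (x - e) x ltac:(by rewrite ltrBlDr ltrDl).
rewrite in_itv/= => /andP[p1 p2].
have [q] := @rat_in_itvoo R x (x + e) ltac:(by rewrite ltrDl).
rewrite in_itv/= => /andP[q1 q2].
have IU : I (p, q) `<=` U.
  move=> y; rewrite /I /= in_itv/= => /andP[y1 y2]; apply: eU.
  rewrite ball_itv/= in_itv/= (lt_trans p1 y1)/=; exact: lt_trans y2 q2.
have [n nE] : exists n, unpickle n = Some (p, q).
  by exists (pickle (p, q)); rewrite pickleK.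
exists n => //; rewrite /F nE ifT.
  by rewrite /I /= in_itv/= p2 q1.
rewrite eq_le measure_ge0 andbT -mU0.
by apply: le_measure => //; rewrite inE;
  [exact: measurable_itv|exact: open_measurable].
Qed.

(** The case alpha_0 = 0, omega_1 = 1, c = 1 + b. *)
Lemma cauchy_transform_meixner (a b : R)
    (mu : probability (measurableTypeR R) R) :
  free_meixner a b mu ->
  \forall z \near cinfty R, forall s : C,
    (1 + b)%:C * s ^+ 2 - (z - a%:C) * s + 1 = 0 -> normc s * normc z <= 4 ->
    cauchy_transform mu z * (z - s) = 1.
Proof.
move=> [/compact_support_carrier[M muM]] [_ [P [monP orthP recP]]].
have P0 : P 0%N = 1.
  have [/monicP + /eqP] := monP 0%N; rewrite /lead_coef => + sP.
  have /size_poly1P[c _ ->] : size (P 0%N) == 1%N by [].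
  by rewrite size_polyC; case: eqP => [->|_]/=; rewrite coefC/= => ->.
have rec : eventually_constant_recurrence 0 1 a (1 + b) P.
  split; [exact: P0| |exact: (recP 1%N)|move=> n; exact: (recP n.+2)].
  by rewrite recP /= scaler0 addr0.
have intP n : \int[mu]_x (P n.+1).[x] = 0.
  rewrite -[RHS](orthP n.+1 0%N)//; apply: eq_Rintegral => x _.
  by rewrite P0 hornerC mulr1.
have := cauchy_transform_of_recurrence (probability_setT mu) muM rec intP.
apply: filterS => z H s sE s4; rewrite -[RHS](H s sE s4).
by congr (_ * _); rewrite subr0 mul1r.
Qed.

(** The right inverse is unique as a germ: far out both the chosen one and K
    take their values where F is one-to-one. *)
Lemma inverse_at_infinity_near (F K : C -> C) :
  right_inverse_at_infinity F K ->
  (forall r, \forall z \near cinfty R, r < normc (K z)) ->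
  \forall z \near cinfty R, inverse_at_infinity F z = K z.
Proof.
move=> FK Koo.
have [r [Finj nearL]] : right_inverse_at_infinity F (inverse_at_infinity F).
  apply: (@xgetPex _ (cst 0) [set L | right_inverse_at_infinity F L]).
  by exists K.
have [r1 [_ nearK]] := FK.
apply: filterS3 nearL nearK (Koo r) => z [rL FL] [_ FKz] rK.
by apply: Finj => //; rewrite FL FKz.
Qed.

(** F_mu(z) = z - S(z), where S and T are the small roots of the quadratic
    equations with leading coefficients 1 + b and b. Both the injectivity of
    F_mu and the identity S(y + T(y)) = T(y) follow from [small_root_unique]. *)
Lemma voiculescu_transform_meixner (a b : R)
    (mu : probability (measurableTypeR R) R) : 0 <= b -> free_meixner a b mu ->
  \forall y \near cinfty R,
    voiculescu_transform mu y = cauchy_transform (semicircle_law a b) y.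
Proof.
move=> b0 hmu.
have b1 : 0 <= 1 + b by rewrite addr_ge0.
pose S := cauchy_transform (semicircle_law a (1 + b)).
pose T := cauchy_transform (semicircle_law a b).
have [r1 _ S_root] := cauchy_transform_semicircle a b1.
have [r2 _ T_root] := cauchy_transform_semicircle a b0.
have [r3 _ G_S] := cauchy_transform_meixner hmu.
(* beyond 5 + 2 b + |a| the values of S and T have norm at most 1, and the
   hypothesis of small_root_unique holds with coefficient b or 1 + b *)
pose r := Num.max (Num.max r1 r2) (Num.max r3 (5 + 2 * b + `|a|)).
have rP z : r < normc z -> [/\ r1 < normc z, r2 < normc z, r3 < normc z &
    5 + 2 * b + `|a| < normc z].
  by rewrite /r !gt_max => /andP[/andP[-> ->] /andP[-> ->]].
have le1 (s z : C) : r < normc z -> normc s * normc z <= 4 -> normc s <= 1.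
  move=> /rP[_ _ _ z5] s4; have z4 : 4 <= normc z by have := normr_ge0 a; lra.
  rewrite leNgt; apply/negP => s1; have := normc_ge0 s; nra.
have SE z : r < normc z ->
    (1 + b)%:C * S z ^+ 2 - (z - a%:C) * S z + 1 = 0 /\ normc (S z) <= 1.
  by move=> rz; have [/S_root[? /(le1 _ _ rz)]] := rP _ rz.
have TE z : r < normc z ->
    b%:C * T z ^+ 2 - (z - a%:C) * T z + 1 = 0 /\ normc (T z) <= 1.
  by move=> rz; have [_ /T_root[? /(le1 _ _ rz)]] := rP _ rz.
have FE z : r < normc z -> F_transform mu z = z - S z.
  move=> rz; have [r1z _ r3z _] := rP _ rz; have [Sq S4] := S_root _ r1z.
  have GS : cauchy_transform mu z * (z - S z) = 1 by exact: G_S.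
  have G0 : cauchy_transform mu z != 0.
    by apply: contra_eq_neq GS => ->; rewrite mul0r eq_sym oner_neq0.
  by apply: (mulfI G0); rewrite GS /F_transform mulfV.
have near_large (M : R) : \forall z \near cinfty R, M < normc z by exists M.
pose K y := y + T y.
have K_large (M : R) : \forall y \near cinfty R, M < normc (K y).
  apply: filterS2 (near_large r) (near_large (M + 1)) => y ry My.
  have [_ T1] := TE _ ry.
  have := le_normcB y (- T y); rewrite opprK normcN -/(K y); lra.
have FK : right_inverse_at_infinity (F_transform mu) K.
  exists r; split.
    move=> z w rz rw; rewrite !FE// => Fzw.
    have [Sz Sz1] := SE _ rz; have [Sw Sw1] := SE _ rw.
    pose f := z - S z.
    have root v : r < normc v -> v - S v = f ->
        b%:C * S v ^+ 2 - (f - a%:C) * S v + 1 = 0.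
      move=> rv <-; have [<- _] := SE _ rv; rewrite rmorphD rmorph1; ring.
    (* both values satisfy the equation obtained by eliminating z *)
    suff SS : S z = S w by have := Fzw; rewrite SS => /addIr.
    apply: (@small_root_unique b%:C (f - a%:C)).
    - exact: root.
    - exact: root.
    rewrite normc_real ger0_norm//.
    have [_ _ _ z5] := rP _ rz.
    have := le_normcB f a%:C; have := le_normcB z (S z).
    have : b * (normc (S z) + normc (S w)) <= b * 2 by rewrite ler_wpM2l//; lra.
    rewrite normc_real -/f; lra.
  apply: filterS2 (near_large r) (K_large r) => y ry rK; split=> //.
  rewrite FE//; have [Ty Ty1] := TE _ ry; have [SK SK1] := SE _ rK.
  suff -> : S (K y) = T y by rewrite /K addrK.
  apply: (small_root_unique SK).
    by rewrite -[RHS]Ty /K rmorphD rmorph1; ring.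
  rewrite normc_real ger0_norm//; have [_ _ _ K5] := rP _ rK.
  apply: (@le_lt_trans _ _ ((1 + b) * (1 + 1))).
    exact: ler_wpM2l b1 _ _ (lerD SK1 Ty1).
  apply: lt_le_trans (le_normcB _ _); rewrite normc_real ltrBrDr.
  apply: le_lt_trans K5.
  by rewrite lerD2r mulrDl mul1r [b * _]mulrC lerD2r -[1 + 1]/(2%:R) ler_nat.
apply: filterS (inverse_at_infinity_near FK K_large) => y KE.
by rewrite /voiculescu_transform KE /K addrC addKr.
Qed.

End free_meixner.

Theorem mainTheorem3 (R : realType) (a b : R)
    (mu : probability (measurableTypeR R) R)
    (hb : -1 < b) (hmu : free_meixner a b mu) :
  (0 <= b ->
     \forall y \near cinfty R,
       voiculescu_transform mu y = cauchy_transform (semicircle_law a b) y) /\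
  (b < 0 ->
     forall eta : probability (measurableTypeR R) R,
       free_meixner a (1 + b) eta ->
       \forall z \near cinfty R,
         voiculescu_transform eta z
           = cauchy_transform (semicircle_law a (1 + b)) z /\
         cauchy_transform mu z
           = meixner_g a b (voiculescu_transform eta z)).
Proof.
have b1 : 0 <= 1 + b by lra.
split=> [b0|_ eta heta]; first exact: voiculescu_transform_meixner.
apply: filterS3 (voiculescu_transform_meixner b1 heta)
  (cauchy_transform_semicircle a b1) (cauchy_transform_meixner hmu).
move=> z phiE [sE s4] GE; split=> //; rewrite phiE.
set s := cauchy_transform _ z in sE s4 *.
have G1 := GE s sE s4.
have s0 : s != 0.
  apply/eqP => s0; move: sE; rewrite s0 expr0n !mulr0 subrr add0r.
  by move/eqP; rewrite oner_eq0.
have zs0 : z - s != 0.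
  by apply: contra_eq_neq G1 => ->; rewrite mulr0 eq_sym oner_neq0.
have denE : 1 + (a%:C * s)%C + (b%:C * s ^+ 2)%C = s * (z - s).
  apply/eqP; rewrite -subr_eq0 -[X in _ == X]sE; apply/eqP.
  rewrite rmorphD rmorph1; ring.
rewrite /meixner_g denE invfM mulrA divff// mul1r.
by apply: (mulIf zs0); rewrite G1 mulVf.
Qed.
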